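(* In compressible isotropic implicit elasticity, all universal deformations are homogeneous. That is, if a deformation $\varphi:\mathcal{B}\to\mathcal{C}=\varphi(\mathcal{B})$ of a body $\mathcal{B}$ in Euclidean three-space is universal for the class of compressible isotropic implicit-elastic solids (controllable for every material in the class), then $\varphi$ is homogeneous, i.e. its left Cauchy-Green strain $\mathbf{b}$ is constant.
   Context: The ambient space is Euclidean $\mathbb{R}^3$; in Cartesian coordinates all tensors below are identified with $3\times 3$ matrices and the metric with the identity $\mathbf{I}$. Deformation: the body in its undeformed configuration is an embedded submanifold $\mathcal{B}$ of the ambient space (connected, three-dimensional), and a deformation is a smooth invertible map $\varphi:\mathcal{B}\to\mathcal{C}=\varphi(\mathcal{B})$ onto the current configuration $\mathcal{C}$, with deformation gradient $\mathbf{F}=\nabla\varphi$, $F_{aA}=\partial\varphi_a/\partial X_A$. ''Compressible'' means that no internal constraint such as incompressibility is imposed. The left Cauchy-Green strain is $\mathbf{b}=\mathbf{F}\mathbf{F}^{\mathsf T}$, regarded as a field on $\mathcal{C}$, and $\mathbf{c}=\mathbf{b}^{-1}$. A deformation is homogeneous if $\mathbf{b}$ is constant. Compressible isotropic implicit-elastic solid: a material specified by nine response functions $\alpha_i=\alpha_i(I_1,\dots,I_{10})$, $i=0,\dots,8$, whose Cauchy stress $\boldsymbol{\sigma}$ (a symmetric tensor field on $\mathcal{C}$) is related to $\mathbf{b}$ by the implicit constitutive equation $$\alpha_0\mathbf{I}+\alpha_1\boldsymbol{\sigma}+\alpha_2\boldsymbol{\sigma}^2+\alpha_3\mathbf{b}+\alpha_4\mathbf{c}+\alpha_5(\boldsymbol{\sigma}\mathbf{b}+\mathbf{b}\boldsymbol{\sigma})+\alpha_6(\boldsymbol{\sigma}^2\mathbf{b}+\mathbf{b}\boldsymbol{\sigma}^2)+\alpha_7(\boldsymbol{\sigma}\mathbf{c}+\mathbf{c}\boldsymbol{\sigma})+\alpha_8(\boldsymbol{\sigma}^2\mathbf{c}+\mathbf{c}\boldsymbol{\sigma}^2)=\mathbf{0}$$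 everywhere in the deformed body, where the $\alpha_i$ are evaluated at $$I_1=\operatorname{tr}\boldsymbol{\sigma},\ I_2=\operatorname{tr}\boldsymbol{\sigma}^2,\ I_3=\operatorname{tr}\boldsymbol{\sigma}^3,\ I_4=\operatorname{tr}\mathbf{b},\ I_5=\tfrac12\left[(\operatorname{tr}\mathbf{b})^2-\operatorname{tr}\mathbf{b}^2\right],\ I_6=\det\mathbf{b},$$ $$I_7=\operatorname{tr}(\boldsymbol{\sigma}\mathbf{b}),\ I_8=\operatorname{tr}(\boldsymbol{\sigma}\mathbf{b}^2),\ I_9=\operatorname{tr}(\boldsymbol{\sigma}^2\mathbf{b}),\ I_{10}=\operatorname{tr}(\boldsymbol{\sigma}^2\mathbf{b}^2).$$ Controllable: for a given material, a deformation is controllable if it can be maintained in the absence of body forces by applying only boundary tractions, i.e. if the Cauchy stress $\boldsymbol{\sigma}$ corresponding to it through the constitutive equation satisfies the equilibrium equations $\operatorname{div}\boldsymbol{\sigma}=\mathbf{0}$ on $\mathcal{C}$ (in Cartesian components, $\sum_b\partial\sigma_{ab}/\partial x_b=0$ for $a=1,2,3$). Universal: a deformation is universal for the class of materials if it is controllable for every material in the class, i.e. if it satisfies the equilibrium equations in the absence of body forces for arbitrary response functions $\alpha_0,\dots,\alpha_8$. *)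

(* Defs.v *)
From HB Require Import structures.
From mathcomp Require Import all_boot all_order all_algebra.
From mathcomp Require Import all_classical all_reals all_analysis.

Set Implicit Arguments.
Unset Strict Implicit.
Unset Printing Implicit Defensive.

Import Order.TTheory GRing.Theory Num.Theory.
Import numFieldNormedType.Exports.

Local Open Scope classical_set_scope.
Local Open Scope ring_scope.

(* Points of R^n are row vectors; 0-based indices throughout. *)
Definition partial {R : realType} {n : nat} (i : 'I_n) (f : 'rV[R]_n -> R)
  (x : 'rV[R]_n) : R := 'D_(delta_mx 0 i) f x.

Fixpoint Ck_on {R : realType} {n : nat} (k : nat) (U : set 'rV[R]_n)
    (f : 'rV[R]_n -> R) : Prop :=
  match k with
  | 0 => forall x, U x -> {for x, continuous f}
  | k'.+1 => (forall x, U x -> differentiable f x) /\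
             forall i : 'I_n, Ck_on k' U (partial i f)
  end.

(* Meant for open U: derivatives are taken in the ambient space. *)
Definition smooth_on {R : realType} {n : nat} (U : set 'rV[R]_n)
  (f : 'rV[R]_n -> R) : Prop := forall k, Ck_on k U f.

Section Kinematics.
Context {R : realType}.
Implicit Types (body : set 'rV[R]_3) (phi psi : 'rV[R]_3 -> 'rV[R]_3).

Definition smooth_map_on body phi : Prop :=
  forall a : 'I_3, smooth_on body (fun X => phi X 0 a).

(* phi and psi are total functions, relevant only on the body and on its image
   respectively; psi is the inverse phi^-1 of the deformation. *)
Record deformation body phi psi : Prop := Deformation {
  body_open : open body;
  body_connected : connected body;
  image_open : open (phi @` body);
  deformation_smooth : smooth_map_on body phi;
  inverse_smooth : smooth_map_on (phi @` body) psi;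
  deformationK : forall X, body X -> psi (phi X) = X }.

Definition deformation_gradient phi (X : 'rV[R]_3) : 'M[R]_3 :=
  \matrix_(a, A) partial A (fun Y => phi Y 0 a) X.

(* b = F F^T as a field on the current configuration, hence the psi. *)
Definition left_cauchy_green phi psi (x : 'rV[R]_3) : 'M[R]_3 :=
  deformation_gradient phi (psi x) *m (deformation_gradient phi (psi x))^T.

Definition homogeneous body phi psi : Prop :=
  exists b0 : 'M[R]_3,
    forall x, (phi @` body) x -> left_cauchy_green phi psi x = b0.

End Kinematics.

Section ImplicitElasticity.
Context {R : realType}.
Implicit Types (C : set 'rV[R]_3) (s b : 'M[R]_3).
Implicit Types (sigma bf : 'rV[R]_3 -> 'M[R]_3).

(* Entry i is I_(i+1). *)
Definition invariants s b : 'rV[R]_10 :=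
  \row_(i < 10)
    [:: \tr s; \tr (s *m s); \tr (s *m s *m s);
        \tr b; 2^-1 * (\tr b ^+ 2 - \tr (b *m b)); \det b;
        \tr (s *m b); \tr (s *m (b *m b));
        \tr (s *m s *m b); \tr (s *m s *m (b *m b))]`_i.

(* Entry i is the tensor multiplied by alpha_i in the constitutive equation. *)
Definition generators s b : seq 'M[R]_3 :=
  let c := invmx b in
  let s2 := s *m s in
  [:: 1%:M; s; s2; b; c;
      s *m b + b *m s; s2 *m b + b *m s2;
      s *m c + c *m s; s2 *m c + c *m s2].

Definition response : Type := 'I_9 -> 'rV[R]_10 -> R.

Definition implicit_elastic_solid (alpha : response) : Prop :=
  forall i, smooth_on [set: 'rV[R]_10] (alpha i).

Definition constitutive_equation (alpha : response) s b : Prop :=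
  \sum_(i < 9) alpha i (invariants s b) *: (generators s b)`_i = 0.

Definition symmetric_tensor_field C sigma : Prop :=
  (forall a d : 'I_3, smooth_on C (fun x => sigma x a d)) /\
  (forall x, C x -> (sigma x)^T = sigma x).

Definition corresponding_stress (alpha : response) C bf sigma : Prop :=
  symmetric_tensor_field C sigma /\
  (forall x, C x -> constitutive_equation alpha (sigma x) (bf x)).

Definition divergence sigma (x : 'rV[R]_3) (a : 'I_3) : R :=
  \sum_(d < 3) partial d (fun y => sigma y a d) x.

Definition equilibrated C sigma : Prop :=
  forall x, C x -> forall a, divergence sigma x a = 0.

Definition controllable (alpha : response) C bf : Prop :=
  exists sigma, corresponding_stress alpha C bf sigma /\ equilibrated C sigma.

(* An implicit equation may have no solution sigma for the given strain (e.g.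
   alpha_0 = 1 and the other alpha_i = 0), and then the material cannot undergo
   the deformation, or many solutions (e.g. all alpha_i = 0), and then no
   deformation has all its stresses equilibrated.  Hence the premise below, and
   the existential in [controllable]: without them no deformation would be
   universal. *)
Definition universal C bf : Prop :=
  forall alpha : response, implicit_elastic_solid alpha ->
    (exists sigma, corresponding_stress alpha C bf sigma) ->
    controllable alpha C bf.

End ImplicitElasticity.

(* Main.v *)
(* With X = psi(x) the inverse deformation, c_ab = sum_A d_a X_A d_b X_A, hence
   div c = sum_A grad X_A (Lap X_A) + grad (tr c) / 2.  Two materials suffice:
   one whose only stress is c, so that div c = 0, and one whose only stress is
   (tr c) I, so that grad (tr c) = 0.  As the grad X_A are independent,
   Lap X_A = 0.  Then 0 = Lap (tr c) / 2 = |grad grad X|^2 + grad X . grad (Lap X)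
   = |grad grad X|^2, so grad X is constant on the connected set C, and so is b. *)
Require Import Defs.
From mathcomp Require Import all_boot all_order all_algebra.
From mathcomp Require Import all_classical all_reals all_analysis.
From mathcomp Require Import ring lra.

Set Implicit Arguments.
Unset Strict Implicit.
Unset Printing Implicit Defensive.

Import Order.TTheory GRing.Theory Num.Theory.
Import numFieldNormedType.Exports.

Local Open Scope classical_set_scope.
Local Open Scope ring_scope.

(** The first-order expansion of [f] at [x] depends only on the germ of [f], so it holds for [g]
    too. Uniqueness of the differential then identifies ['d g x] with ['d f x], which supplies its
    continuity. *)
Lemma near_eq_differentiable (K : numFieldType) (V W : normedModType K)
    (f g : V -> W) (x : V) :
  {near x, f =1 g} -> differentiable f x -> differentiable g x.
Proof.
move=> fg /diff_locallyP[dfc dfE].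
have gE : g \o shift x = cst (g x) + 'd f x +o_ 0 id.
  apply: eqaddoE; apply/eqaddoP => e e0.
  have /eqaddoP/(_ _ e0) fe := dfE.
  have fg0 : \forall h \near 0, f (h + x) = g (h + x).
    have : \forall y \near x, f y = g y by exact: fg.
    by rewrite nbhs0P; apply: filterS => h; rewrite addrC.
  rewrite -(nbhs_singleton fg); apply: filterS2 fe fg0 => h.
  by rewrite !fctE /= => + <-.
have dgE := diff_unique dfc gE.
by apply/diff_locallyP; rewrite dgE.
Qed.

(** * Partial derivatives: calculus rules, symmetry of second derivatives, constancy on connected
    sets *)

Section PartialDerivatives.
Context {R : realType} {n : nat}.
Implicit Types (U : set 'rV[R]_n) (f g : 'rV[R]_n -> R) (x : 'rV[R]_n).
Implicit Types (i j : 'I_n).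

Lemma partialD i f g x : differentiable f x -> differentiable g x ->
  partial i (fun y => f y + g y) x = partial i f x + partial i g x.
Proof. by move=> df dg; apply: deriveD; exact: diff_derivable. Qed.

Lemma partialM i f g x : differentiable f x -> differentiable g x ->
  partial i (fun y => f y * g y) x = f x * partial i g x + g x * partial i f x.
Proof. by move=> df dg; apply: deriveM; exact: diff_derivable. Qed.

Lemma partial_cst i (a : R) x : partial i (fun=> a) x = 0.
Proof. exact: derive_cst. Qed.

(** Both facts share one induction: the sum rule at each step needs the tail to be
    differentiable. *)
Lemma partial_sum (I : Type) (r : seq I) i (h : I -> 'rV[R]_n -> R) x :
  (forall k, differentiable (h k) x) ->
  differentiable (fun y => \sum_(k <- r) h k y) x /\
  partial i (fun y => \sum_(k <- r) h k y) x = \sum_(k <- r) partial i (h k) x.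
Proof.
move=> dh; elim: r => [|k r [dr pr]].
  under eq_fun do rewrite big_nil.
  by rewrite big_nil partial_cst; split.
under eq_fun do rewrite big_cons.
rewrite big_cons; split; first exact: differentiableD.
by rewrite partialD// pr.
Qed.

Lemma eq_partial U i f g : open U -> (forall x, U x -> f x = g x) ->
  forall x, U x -> partial i f x = partial i g x.
Proof.
move=> Uo fg x Ux; apply: near_eq_derive.
by apply: filterS (open_nbhs_nbhs (conj Uo Ux)) => y /fg.
Qed.

(** Openness of [U] turns equality on [U] into equality near each point, which passes to derivatives
    of every order. *)
Lemma eq_Ck_on k U f g : open U -> (forall x, U x -> f x = g x) ->
  Ck_on k U f -> Ck_on k U g.
Proof.
move=> Uo; elim: k f g => [|k IH] f g fg.
  move=> cf x Ux; have fgx : {near x, f =1 g}.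
    by apply: filterS (open_nbhs_nbhs (conj Uo Ux)) => y /fg.
  rewrite /prop_for /continuous_at -(fg x Ux).
  exact: cvg_trans (near_eq_cvg fgx) (cf x Ux).
case=> df pf; split=> [x Ux|i].
  apply: near_eq_differentiable (df x Ux).
  by apply: filterS (open_nbhs_nbhs (conj Uo Ux)) => y /fg.
by apply: IH (pf i); exact: eq_partial.
Qed.

Lemma sub_Ck_on k U U' f : U `<=` U' -> Ck_on k U' f -> Ck_on k U f.
Proof.
move=> UU'; elim: k f => [|k IH] f; first by move=> cf x /UU' /(cf x).
by case=> df pf; split=> [x /UU'/df|i] //; exact: IH (pf i).
Qed.

Lemma Ck_on_pred k U f : Ck_on k.+1 U f -> Ck_on k U f.
Proof.
elim: k f => [|k IH] f [df pf].
  by move=> x Ux; apply: differentiable_continuous; exact: df.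
by split=> // i; apply: IH; exact: pf.
Qed.

Lemma Ck_onD k U f g : open U -> Ck_on k U f -> Ck_on k U g ->
  Ck_on k U (fun x => f x + g x).
Proof.
move=> Uo; elim: k f g => [|k IH] f g.
  by move=> cf cg x Ux; exact: (continuousD (cf x Ux) (cg x Ux)).
case=> df pf [dg pg]; split=> [x Ux|i].
  by apply: differentiableD; [exact: df|exact: dg].
apply: eq_Ck_on (IH _ _ (pf i) (pg i)) => // x Ux.
by rewrite partialD//; [exact: df|exact: dg].
Qed.

Lemma Ck_onM k U f g : open U -> Ck_on k U f -> Ck_on k U g ->
  Ck_on k U (fun x => f x * g x).
Proof.
move=> Uo; elim: k f g => [|k IH] f g.
  by move=> cf cg x Ux; exact: (continuousM (cf x Ux) (cg x Ux)).
move=> sf sg; have [df pf] := sf; have [dg pg] := sg.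
split=> [x Ux|i].
  by apply: differentiableM; [exact: df|exact: dg].
apply: eq_Ck_on (Ck_onD Uo (IH _ _ (Ck_on_pred sf) (pg i))
                           (IH _ _ (Ck_on_pred sg) (pf i))) => // x Ux.
by rewrite partialM//; [exact: df|exact: dg].
Qed.

Lemma Ck_on_cst k U (a : R) : Ck_on k U (fun=> a).
Proof.
elim: k a => [|k IH] a; first by move=> x _; exact: cst_continuous.
split=> [x _|i]; first exact: differentiable_cst.
have -> : partial i (fun=> a) = fun=> 0 by apply/funext => x; exact: partial_cst.
exact: IH.
Qed.

Lemma partial_coord i j x : partial j (fun y => y 0 i) x = (i == j)%:R.
Proof.
have idD := @derivable_id R _ x (delta_mx 0 j : 'rV[R]_n).
have := derive_mx idD; rewrite derive_id => /matrixP/(_ 0 i).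
by rewrite [in RHS]mxE mxE /= => ->.
Qed.

Lemma Ck_on_coord k U i : Ck_on k U (fun x => x 0 i).
Proof.
have dc x : differentiable (fun y : 'rV[R]_n => y 0 i) x.
  exact: differentiable_coord.
case: k => [|k]; first by move=> x _; exact: differentiable_continuous.
split=> [x _|j]; first exact: dc.
have -> : partial j (fun y => y 0 i) = fun=> (i == j)%:R : R.
  by apply/funext => x; exact: partial_coord.
exact: Ck_on_cst.
Qed.

Lemma smooth_on_partial U i f : smooth_on U f -> smooth_on U (partial i f).
Proof. by move=> sf k; have [_ /(_ i)] := sf k.+1. Qed.

Lemma smooth_on_differentiable U f x :
  smooth_on U f -> U x -> differentiable f x.
Proof. by move=> sf Ux; have [/(_ x Ux)] := sf 1%N. Qed.

Lemma smooth_on_sum (I : Type) (r : seq I) U (h : I -> 'rV[R]_n -> R) :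
  open U -> (forall k, smooth_on U (h k)) ->
  smooth_on U (fun x => \sum_(k <- r) h k x).
Proof.
move=> Uo sh m; elim: r => [|k r IH].
  by under eq_fun do rewrite big_nil; exact: Ck_on_cst.
by under eq_fun do rewrite big_cons; apply: Ck_onD => //; exact: sh.
Qed.

Lemma deriv_partialE f x (v : 'rV[R]_n) : differentiable f x ->
  'D_v f x = \sum_i v 0 i * partial i f x.
Proof.
move=> df; rewrite deriveE// {1}(row_sum_delta v) linear_sum.
by apply: eq_bigr => i _; rewrite linearZ /partial deriveE.
Qed.

Lemma differentiable_row_comp m (g : 'rV[R]_n -> 'rV[R]_m) x :
  (forall a, differentiable (fun y => g y 0 a) x) -> differentiable g x.
Proof.
move=> dg; have -> : g = \sum_a (fun y => g y 0 a *: delta_mx 0 a).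
  by apply/funext => y; rewrite fct_sumE [LHS]row_sum_delta.
by apply: differentiable_sum => a; exact: differentiableZl.
Qed.

(** The one-variable mean value theorem for [t |-> f (t *: v + x)] on [[0, 1]]. *)
Lemma MVT_dir f x (v : 'rV[R]_n) :
    (forall t : R, 0 <= t <= 1 -> derivable f (t *: v + x) v) ->
  exists2 t : R, 0 <= t <= 1 & f (v + x) - f x = 'D_v f (t *: v + x).
Proof.
move=> df; pose g (t : R) := f (t *: v + x).
have gD (t : R) : 0 <= t <= 1 -> is_derive t (1 : R) g ('D_v f (t *: v + x)).
  (* The difference quotients of [g] at [t] are those of [f] along [v], so derivability and value
     transfer together. *)
  move=> t01; have quotE (h : R) :
      h^-1 *: (g (h *: (1 : R) + t) - g t) =
      h^-1 *: (f (h *: v + (t *: v + x)) - f (t *: v + x)).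
    by rewrite /g [h *: 1]mulr1 scalerDl addrA.
  have quotEf := funext quotE; apply: DeriveDef; last first.
    by rewrite /derive [X in lim (X @ _) = _]quotEf.
  rewrite /derivable [X in cvg (X @ _)]quotEf.
  exact: df.
have gc : {within `[0, 1], continuous g}.
  apply: derivable_within_continuous => t.
  by rewrite in_itv/= => /gD[].
have gD' (t : R) : t \in `]0, 1[ -> is_derive t (1 : R) g ('D_v f (t *: v + x)).
  by rewrite in_itv/= => /andP[t0 t1]; apply: gD; rewrite !ltW.
have [t] := MVT ltr01 gD' gc.
rewrite in_itv/= => /andP[t0 t1]; rewrite subr0 mulr1 /g scale1r scale0r add0r.
by move=> ->; exists t; rewrite // !ltW.
Qed.

Lemma is_derive_shiftV f (w x v : 'rV[R]_n) (a : R) :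
  is_derive (w + x) v f a -> is_derive x v (fun y => f (w + y)) a.
Proof.
move=> [fv fE].
have quotE (h : R) : h^-1 *: (f (w + (h *: v + x)) - f (w + x)) =
    h^-1 *: (f (h *: v + (w + x)) - f (w + x)) by rewrite (addrCA w).
have quotEf := funext quotE; apply: DeriveDef.
  by rewrite /derivable [X in cvg (X @ _)]quotEf.
by rewrite /derive [X in lim (X @ _) = _]quotEf.
Qed.

(** Two mean value steps, as in the classical proof of Schwarz's theorem: along [v] for the
    increment [f (w + y) - f y], then along [w] for [partial i f]. *)
Lemma second_difference U f x (h k : R) i j
    (v := h *: delta_mx 0 i : 'rV[R]_n) (w := k *: delta_mx 0 j : 'rV[R]_n) :
    (forall s t : R, 0 <= s <= 1 -> 0 <= t <= 1 -> U (s *: v + (t *: w + x))) ->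
    smooth_on U f ->
  exists st, [/\ 0 <= st.1 <= 1, 0 <= st.2 <= 1 &
    f (v + (w + x)) - f (w + x) - (f (v + x) - f x) =
    h * (k * partial j (partial i f) (st.1 *: v + (st.2 *: w + x)))].
Proof.
move=> Ubox sf; have df y : U y -> differentiable f y.
  by move=> Uy; exact: smooth_on_differentiable sf Uy.
have dpf y : U y -> differentiable (partial i f) y.
  by move=> Uy; exact: smooth_on_differentiable (smooth_on_partial i sf) Uy.
have I0 : 0 <= (0 : R) <= 1 by rewrite lexx ler01.
have I1 : 0 <= (1 : R) <= 1 by rewrite ler01 lexx.
have Ux (s : R) : 0 <= s <= 1 -> U (s *: v + x).
  by move=> s01; have := Ubox s 0 s01 I0; rewrite scale0r add0r.
have Uw (s : R) : 0 <= s <= 1 -> U (s *: v + (w + x)).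
  by move=> s01; have := Ubox s 1 s01 I1; rewrite scale1r.
have dirE (a : R) l (F : 'rV[R]_n -> R) y : differentiable F y ->
    'D_(a *: delta_mx 0 l) F y = a * partial l F y.
  by move=> dF; rewrite deriveE// linearZ /partial deriveE.
pose g y := f (w + y) - f y.
have wC y (s : R) : s *: v + (w + y) = w + (s *: v + y) by rewrite addrCA.
have dfw (s : R) : 0 <= s <= 1 -> is_derive (s *: v + x) v
    (fun y => f (w + y)) (h * partial i f (s *: v + (w + x))).
  move=> s01; have dfs := df _ (Uw s s01).
  by apply: is_derive_shiftV; rewrite -wC -dirE//; exact/derivableP/diff_derivable.
have dg (s : R) : 0 <= s <= 1 -> derivable g (s *: v + x) v.
  move=> s01; apply: derivableB; first by case: (dfw s s01).
  exact/diff_derivable/df/Ux.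
have [s s01] := MVT_dir dg; rewrite /g.
have -> : 'D_v g (s *: v + x) =
    h * (partial i f (w + (s *: v + x)) - partial i f (s *: v + x)).
  have [d1 d1E] := dfw s s01; have d2 := df _ (Ux s s01).
  have gB := @deriveB _ _ _ _ _ _ v d1 (diff_derivable d2).
  by rewrite -/g in gB; rewrite [LHS]gB d1E wC (dirE _ _ _ _ d2) mulrBr.
move=> gE; have dps (t : R) : 0 <= t <= 1 ->
    differentiable (partial i f) (t *: w + (s *: v + x)).
  by move=> t01; rewrite (addrCA (t *: w)); apply/dpf/Ubox.
have [t t01 tE] := MVT_dir (fun t t01 => diff_derivable (dps t t01)).
exists (s, t); split => //=.
have -> : s *: v + (t *: w + x) = t *: w + (s *: v + x) by rewrite addrCA.
move: gE; rewrite -/g tE dirE; last exact: dps.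
by move=> <-; rewrite (addrCA w v x); ring.
Qed.

(** The second difference with equal steps is symmetric in [i] and [j]. Evaluating it in both orders
    and cancelling [h] twice equates the mixed partials at two intermediate points. *)
Lemma mixed_partials_ball f i j x (r : R) : 0 < r -> smooth_on (ball x r) f ->
  exists yz, [/\ ball x r yz.1, ball x r yz.2 &
    partial j (partial i f) yz.1 = partial i (partial j f) yz.2].
Proof.
(* Points of the box of side [h] lie within [2 h = r / 2] of [x], hence in the ball. *)
move=> r0 sf; pose h := r / 4.
have h0 : 0 < h by rewrite divr_gt0.
have inball k l (s t : R) : 0 <= s <= 1 -> 0 <= t <= 1 ->
    ball x r (s *: (h *: (delta_mx 0 k : 'rV[R]_n)) +
              (t *: (h *: (delta_mx 0 l : 'rV[R]_n)) + x)).
  move=> /andP[s0 s1] /andP[t0 t1]; rewrite -ball_normE /=.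
  have d1 m : `|delta_mx 0 m : 'rV[R]_n| <= 1.
    rewrite [leLHS]/Num.Def.normr/= mx_normrE; apply: bigmax_le => // p _.
    by rewrite mxE; case: (_ && _); rewrite ?normr1 ?normr0.
  have bnd (a : R) m : 0 <= a -> a <= 1 ->
      `|a *: (h *: (delta_mx 0 m : 'rV[R]_n))| <= h.
    move=> a0 a1; rewrite normrZ (ger0_norm a0) normrZ (gtr0_norm h0).
    apply: (@le_trans _ _ (1 * (h * 1))); last by rewrite mul1r mulr1.
    by apply: ler_pM => //; [rewrite mulr_ge0// ltW|rewrite ler_pM2l].
  rewrite distrC addrA addrK (le_lt_trans (ler_normD _ _))//.
  apply: (@le_lt_trans _ _ (h + h)); first by rewrite lerD// bnd.
  by rewrite /h; lra.
have [[s t] [/= s01 t01 E1]] := second_difference (inball i j) sf.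
have [[s' t'] [/= s01' t01' E2]] := second_difference (inball j i) sf.
exists (s *: (h *: delta_mx 0 i) + (t *: (h *: delta_mx 0 j) + x),
        s' *: (h *: delta_mx 0 j) + (t' *: (h *: delta_mx 0 i) + x)).
split; [exact: inball|exact: inball|].
apply: (mulfI (lt0r_neq0 h0)); apply: (mulfI (lt0r_neq0 h0)).
apply: etrans (esym E1) _; apply: etrans E2.
by rewrite (addrCA (h *: delta_mx 0 j) (h *: delta_mx 0 i) x); ring.
Qed.

Lemma dist_le_half (e a b c : R) :
  `|a - c| < e / 2 -> `|b - c| < e / 2 -> `|b - a| <= e.
Proof.
move=> ac bc; rewrite (le_trans (ler_distD c _ _))// (splitr e).
by rewrite lerD// ltW// distrC.
Qed.

(** Schwarz's theorem: every small ball around [x] contains two points where the respective mixed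
    partials take the same value, and both are continuous at [x]. *)
Lemma partialC U f i j : open U -> smooth_on U f ->
  forall x, U x -> partial i (partial j f) x = partial j (partial i f) x.
Proof.
move=> Uo sf x Ux.
have cF := smooth_on_partial j (smooth_on_partial i sf) 0%N x Ux.
have cG := smooth_on_partial i (smooth_on_partial j sf) 0%N x Ux.
apply/eqP; rewrite -subr_eq0 -normr_le0; apply/ler_addgt0Pr => e e0.
rewrite add0r; have e20 : 0 < e / 2 by rewrite divr_gt0.
have /cvgrPdist_lt/(_ _ e20) nF := cF.
have /cvgrPdist_lt/(_ _ e20) nG := cG.
have nU : \forall y \near x, U y := open_nbhs_nbhs (conj Uo Ux).
have [r /= r0 rP] := (nbhs_ballP _ _).1 (filterI nU (filterI nF nG)).
have sfr : smooth_on (ball x r) f.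
  by move=> k; apply: sub_Ck_on (sf k) => y /rP[].
have [[y z] [/= /rP[_ [Fy _]] /rP[_ [_ Gz]] yz]] := mixed_partials_ball i j r0 sfr.
exact: dist_le_half (eq_ind _ (fun a => `|_ - a| < e / 2) Fy _ yz) Gz.
Qed.

(** The mean value theorem on segments inside a small ball makes [f] locally constant, so its level
    sets are open and closed in [U]. *)
Lemma zero_partial_cst U f : open U -> connected U ->
    (forall x, U x -> differentiable f x) ->
    (forall i x, U x -> partial i f x = 0) ->
  forall x y, U x -> U y -> f x = f y.
Proof.
move=> Uo Uc df pf0 x y Ux Uy.
have loc z : U z -> \forall z' \near z, U z' /\ f z' = f z.
  move=> Uz; have /nbhs_ballP[r /= r0 rU] := open_nbhs_nbhs (conj Uo Uz).
  apply/nbhs_ballP; exists r => //= z' zz'; split; first exact: rU.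
  have inU (t : R) : 0 <= t <= 1 -> U (t *: (z' - z) + z).
    move=> /andP[t0 t1]; apply: rU; move: zz'; rewrite -ball_normE /= => zz'.
    rewrite distrC addrK normrZ ger0_norm//; apply: le_lt_trans zz'.
    by rewrite distrC ler_piMl.
  have [t t01] := @MVT_dir f z (z' - z) (fun t t01 => diff_derivable (df _ (inU t t01))).
  rewrite subrK deriv_partialE; last exact/df/inU.
  rewrite big1 => [/eqP|i _]; first by rewrite subr_eq0 => /eqP.
  by rewrite pf0 ?mulr0//; exact: inU.
pose B := U `&` [set z | f z = f x].
suff BU : B = U by have : U y by []; rewrite -BU => -[].
apply: Uc; first by exists x.
  exists [set z | \forall z' \near z, U z' /\ f z' = f x].
    exact: open_interior.
  apply/seteqP; split=> z /= [Uz].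
    by move=> fzx; split => //; have := loc z Uz; rewrite fzx.
  by move=> /nbhs_singleton[_ fzx]; split.
(* Relative closedness: by local constancy, [f <> f x] also holds on an open set, whose complement
   cuts out [B]. *)
exists (~` [set z | \forall z' \near z, U z' /\ f z' <> f x]).
  by apply: open_closedC; exact: open_interior.
apply/seteqP; split=> z /= [Uz fz]; split => //.
  by move=> /nbhs_singleton[].
apply: contrapT => fzx; apply: fz.
by apply: filterS (loc z Uz) => z' [Uz' ->]; split.
Qed.

End PartialDerivatives.

Lemma partial_comp (R : realType) (m n : nat) (f : 'rV[R]_m -> R)
    (g : 'rV[R]_n -> 'rV[R]_m) (x : 'rV[R]_n) (i : 'I_n) :
    (forall a, differentiable (fun y => g y 0 a) x) -> differentiable f (g x) ->
  partial i (f \o g) x =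
  \sum_a partial i (fun y => g y 0 a) x * partial a f (g x).
Proof.
move=> dg df; have dgx := differentiable_row_comp dg.
rewrite /partial (deriveE _ (differentiable_comp dgx df)) (diff_comp dgx df) /=.
rewrite -(deriveE _ df) deriv_partialE//; apply: eq_bigr => a _.
congr (_ * _); rewrite -(deriveE _ dgx) (derive_mx (diff_derivable dgx)).
by rewrite mxE.
Qed.

(** * Maps whose induced metric is divergence-free and has constant trace *)

Section HarmonicConstantNorm.
Context {R : realType} {m n : nat}.
Variables (U : set 'rV[R]_n) (u : 'I_m -> 'rV[R]_n -> R).
Hypotheses (Uo : open U) (su : forall A, smooth_on U (u A)).

Let P (a : 'I_n) (A : 'I_m) := partial a (u A).
(** The squared Frobenius norm of the gradient of [u]; for the inverse deformation this is
    [tr c]. *)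
Let energy x := \sum_d \sum_A P d A x * P d A x.

Let dP a A x : U x -> differentiable (P a A) x.
Proof. exact/smooth_on_differentiable/smooth_on_partial. Qed.

Let dPP a d A x : U x -> differentiable (partial d (P a A)) x.
Proof. exact/smooth_on_differentiable/smooth_on_partial/smooth_on_partial. Qed.

Lemma partial_energy a x : U x ->
  partial a energy x = 2 * \sum_d \sum_A P d A x * partial a (P d A) x.
Proof.
move=> Ux; have dq d A : differentiable (fun y => P d A y * P d A y) x.
  by apply: differentiableM; exact: dP.
have dr d : differentiable (fun y => \sum_A P d A y * P d A y) x.
  by case: (partial_sum (index_enum _) a (dq d)).
have [_ ->] := partial_sum (index_enum _) a dr.
rewrite mulr_sumr; apply: eq_bigr => d _.
have [_ ->] := partial_sum (index_enum _) a (dq d).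
rewrite mulr_sumr; apply: eq_bigr => A _.
by rewrite (partialM _ (dP _ _ Ux) (dP _ _ Ux)); ring.
Qed.

(** The product rule gives a Laplacian term and a cross term; symmetry of second derivatives turns
    the latter into half the gradient of [energy]. *)
Lemma divergence_metric a x : U x ->
  \sum_d partial d (fun y => \sum_A P a A y * P d A y) x =
  \sum_A P a A x * (\sum_d partial d (P d A) x) + 2^-1 * partial a energy x.
Proof.
move=> Ux; rewrite partial_energy// mulrA mulVf// mul1r.
have dq d A : differentiable (fun y => P a A y * P d A y) x.
  by apply: differentiableM; exact: dP.
transitivity (\sum_d \sum_A (P a A x * partial d (P d A) x +
                             P d A x * partial a (P d A) x)).
  apply: eq_bigr => d _; have [_ ->] := partial_sum (index_enum _) d (dq d).
  apply: eq_bigr => A _; rewrite (partialM _ (dP _ _ Ux) (dP _ _ Ux)).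
  by rewrite [partial d (P a A) x](partialC d a Uo (su A) Ux).
under eq_bigr do rewrite big_split; rewrite big_split; congr (_ + _).
by rewrite exchange_big; apply: eq_bigr => A _; rewrite mulr_sumr.
Qed.

(** The right inverse [F] expresses independence of the gradients of the [u A]. It forces each [u A]
    to be harmonic, and then the Laplacian of the constant [energy] is twice the squared norm of the
    second derivatives. *)
Lemma hessian_eq0 :
    (forall x, U x -> exists F : 'M[R]_(n, m),
      (\matrix_(A, a) P a A x) *m F = 1%:M) ->
    (forall a x, U x ->
      \sum_d partial d (fun y => \sum_A P a A y * P d A y) x = 0) ->
    (forall a x, U x -> partial a energy x = 0) ->
  forall a d A x, U x -> partial a (P d A) x = 0.
Proof.
move=> Ginj divc gradc; pose L A x := \sum_d partial d (P d A) x.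
have L0 A x : U x -> L A x = 0.
  move=> Ux; have [F GF] := Ginj x Ux.
  have LG : (\row_B L B x) *m (\matrix_(B, a) P a B x) = 0.
    apply/rowP => a; rewrite !mxE; have := divc a x Ux.
    rewrite divergence_metric// gradc// mulr0 addr0; apply: etrans.
    by apply: eq_bigr => B _; rewrite !mxE mulrC.
  (* Multiplying on the right by [F] cancels the gradient matrix. *)
  have : \row_B L B x = 0 by rewrite -[LHS]mulmx1 -GF mulmxA LG mul0mx.
  by move=> /rowP/(_ A); rewrite !mxE.
(* Differentiating [L A = 0] along [d] and commuting derivatives twice shows that each [P d A] is
   harmonic as well. *)
have lapP d A x : U x -> \sum_a partial a (partial a (P d A)) x = 0.
  move=> Ux; have := eq_partial d Uo (L0 A) Ux; rewrite partial_cst /L.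
  have [_ ->] := partial_sum (index_enum _) d (fun a => dPP a a A Ux).
  apply: etrans; apply: eq_bigr => a _.
  rewrite [RHS](partialC d a Uo (smooth_on_partial a (su A)) Ux).
  apply: (eq_partial _ Uo _ Ux) => y Uy.
  exact: (partialC a d Uo (su A) Uy).
move=> a d A x Ux.
have hess2 : \sum_b \sum_e \sum_B partial b (P e B) x ^+ 2 = 0.
  (* The added terms sum over [b] to [P e B] times its Laplacian, which vanishes; they complete the
     summand to a derivative of a product. *)
  transitivity (\sum_b \sum_e \sum_B (partial b (P e B) x ^+ 2 +
                                      P e B x * partial b (partial b (P e B)) x)).
    under [RHS]eq_bigr do under eq_bigr do rewrite big_split.
    under [RHS]eq_bigr do rewrite big_split.
    rewrite big_split /= -[LHS]addr0; congr (_ + _); apply/esym.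
    rewrite exchange_big big1// => e _; rewrite exchange_big big1// => B _.
    by rewrite -mulr_sumr lapP// mulr0.
  rewrite big1// => b _.
  (* [g] is half of [partial b energy], so it vanishes on [U]; its derivative along [b] is the
     summand at hand. *)
  pose g y := \sum_e \sum_B P e B y * partial b (P e B) y.
  have g0 y : U y -> g y = 0.
    move=> Uy; have := gradc b y Uy; rewrite partial_energy// => /eqP.
    by rewrite mulf_eq0 pnatr_eq0 /= => /eqP.
  have := eq_partial b Uo g0 Ux; rewrite partial_cst; apply: etrans; apply/esym.
  have dq e B : differentiable (fun y => P e B y * partial b (P e B) y) x.
    by apply: differentiableM; [exact: dP|exact: dPP].
  have dr e : differentiable (fun y => \sum_B P e B y * partial b (P e B) y) x.
    by case: (partial_sum (index_enum _) b (dq e)).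
  have [_ ->] := partial_sum (index_enum _) b dr; apply: eq_bigr => e _.
  have [_ ->] := partial_sum (index_enum _) b (dq e); apply: eq_bigr => B _.
  exact: etrans (partialM _ (dP _ _ Ux) (dPP _ _ _ Ux)) (addrC _ _).
have s0 b e : 0 <= \sum_B partial b (P e B) x ^+ 2.
  by apply: sumr_ge0 => B _; exact: sqr_ge0.
(* A vanishing sum of squares has vanishing terms; the three indices are peeled off in turn. *)
move: hess2 => /eqP; rewrite psumr_eq0 => [/allP/(_ a)|b _]; last exact: sumr_ge0.
rewrite mem_index_enum => /(_ isT)/=.
rewrite psumr_eq0 => [/allP/(_ d)|//]; rewrite mem_index_enum => /(_ isT)/=.
rewrite psumr_eq0 => [/allP/(_ A)|B _]; last exact: sqr_ge0.
by rewrite mem_index_enum => /(_ isT)/=; rewrite sqrf_eq0 => /eqP.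
Qed.

End HarmonicConstantNorm.

(** * The second principal invariant of a 3 by 3 matrix as the trace of its adjugate *)

Section InvariantTrace.
Variable F : fieldType.

Lemma det_mx22 (M : 'M[F]_2) : \det M = M 0 0 * M 1 1 - M 0 1 * M 1 0.
Proof.
rewrite (expand_det_row _ 0) !big_ord_recl big_ord0 /cofactor !det_mx11 !mxE /=.
have -> : lift (0 : 'I_2) 0 = 1 by apply/val_inj.
have -> : lift (1 : 'I_2) 0 = 0 by apply/val_inj.
by ring.
Qed.

(** In terms of eigenvalues, both sides are twice the second elementary symmetric function. The
    identity ties [I_5] to the trace of the inverse of [b]. *)
Lemma tr_adj33 (M : 'M[F]_3) :
  2 * \tr (\adj M) = \tr M ^+ 2 - \tr (M *m M).
Proof.
rewrite /mxtrace !big_ord_recl !big_ord0 !mxE /cofactor !det_mx22 !mxE.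
rewrite !big_ord_recl !big_ord0.
(* Indexing entries by natural numbers lets the ordinals built by [lift] reduce to numerals, so that
   [ring] recognizes equal entries. *)
pose m (i j : nat) := M (inord i) (inord j).
have E i j : M i j = m i j by rewrite /m !inord_val.
rewrite !E /= /bump /=.
by ring.
Qed.
End InvariantTrace.

(** * The gradient of the inverse deformation and the current configuration *)

Section Kinematics.
Context {R : realType}.
Variables (body : set 'rV[R]_3) (phi psi : 'rV[R]_3 -> 'rV[R]_3).
Hypothesis def : deformation body phi psi.

Let C := phi @` body.
Let G := deformation_gradient psi.

(** The chain rule applied to [psi \o phi], which is the identity on the open set [body]. *)
Lemma inverse_gradientM X : body X ->
  G (phi X) *m deformation_gradient phi X = 1%:M.
Proof.
case: def => bo _ _ sphi spsi phiK bX; apply/matrixP => A B; rewrite !mxE.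
have dphi a : differentiable (fun Y => phi Y 0 a) X.
  exact: smooth_on_differentiable (sphi a) bX.
have dpsi : differentiable (fun y => psi y 0 A) (phi X).
  by apply: smooth_on_differentiable (spsi A) _; exists X.
rewrite -(partial_coord A B X).
have /(eq_partial B bo)/(_ X bX) <- :
    forall Y, body Y -> ((fun y => psi y 0 A) \o phi) Y = Y 0 A.
  by move=> Y /phiK /= ->.
rewrite (partial_comp B dphi dpsi); apply: eq_bigr => a _.
by rewrite !mxE mulrC.
Qed.

Lemma inverse_gradient_imageM x : C x ->
  G x *m deformation_gradient phi (psi x) = 1%:M.
Proof.
by case=> X bX <-; rewrite (deformationK def bX) inverse_gradientM.
Qed.

(** With [F] the deformation gradient, the inner factor of [F F^T G^T G] is [(G F)^T = 1], and the
    remaining [F G] is [1] because the matrices are square. *)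
Lemma left_cauchy_greenV x : C x ->
  left_cauchy_green phi psi x *m ((G x)^T *m G x) = 1%:M.
Proof.
move=> Cx; have GF := inverse_gradient_imageM Cx; have FG := mulmx1C GF.
rewrite /left_cauchy_green -mulmxA (mulmxA _ _ (G x)) -trmx_mul GF.
by rewrite trmx1 mul1mx FG.
Qed.

Lemma connected_image : connected C.
Proof.
apply: connected_continuous_connected (body_connected def) _.
apply: continuous_in_subspaceT => X /set_mem bX.
apply/differentiable_continuous/differentiable_row_comp => a.
exact: smooth_on_differentiable (deformation_smooth def a) bX.
Qed.

End Kinematics.

(** * Two materials with a uniquely determined stress *)

Section Materials.
Context {R : realType}.
Implicit Types (C : set 'rV[R]_3) (S bf : 'rV[R]_3 -> 'M[R]_3).

(** [S] itself meets the solvability premise of [universal]. The equilibrated stress thus obtained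
    equals [S] on [C] by uniqueness, and has the same divergence since [C] is open. *)
Lemma universal_equilibrated (alpha : response) C bf S :
    open C -> implicit_elastic_solid alpha -> symmetric_tensor_field C S ->
    (forall x s, C x -> constitutive_equation alpha s (bf x) <-> s = S x) ->
  universal C bf -> equilibrated C S.
Proof.
move=> Co sa symS uniqS univ.
have [|T [[_ Tx] eqT]] := univ alpha sa.
  by exists S; split => // x Cx; exact/uniqS.
move=> x Cx a; rewrite -[RHS](eqT x Cx a); apply: eq_bigr => d _.
by apply: (eq_partial _ Co _ Cx) => y Cy; rewrite (iffLR (uniqS y _ Cy) (Tx y Cy)).
Qed.

(* [sigma - c = 0] *)
Definition inverse_strain_solid : @response R :=
  fun i _ => [:: 0; 1; 0; 0; -1]`_i.

Lemma inverse_strain_solid_smooth : implicit_elastic_solid inverse_strain_solid.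
Proof. by move=> i k; exact: Ck_on_cst. Qed.

Lemma inverse_strain_solidE (s b : 'M[R]_3) :
  constitutive_equation inverse_strain_solid s b <-> s = invmx b.
Proof.
(* Indices past the end of the coefficient list get the default 0, so only [s] and [invmx b]
   survive, with coefficients 1 and -1. *)
rewrite /constitutive_equation /inverse_strain_solid !big_ord_recl big_ord0 /=.
rewrite !scale0r !addr0 !add0r scale1r scaleN1r.
by split=> [/eqP|->]; rewrite ?subrr// subr_eq0 => /eqP.
Qed.

(* [- I_5 1 + I_6 sigma = 0]; by Cayley-Hamilton [I_5 = I_6 tr c]. *)
Definition spherical_solid : @response R :=
  fun i v => [:: -1 * v 0 (inord 4); v 0 (inord 5)]`_i.

Lemma spherical_solid_smooth : implicit_elastic_solid spherical_solid.
Proof.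
move=> [[|[|i]] ilt] k; rewrite /spherical_solid /=.
- exact: (Ck_onM openT (@Ck_on_cst _ _ _ _ _) (@Ck_on_coord _ _ _ _ _)).
- exact: Ck_on_coord.
- by under eq_fun do rewrite nth_nil; exact: Ck_on_cst.
Qed.

(** The adjugate of an invertible [b] is [\det b *: invmx b], so [\det b] factors out of the whole
    equation and can be cancelled. *)
Lemma spherical_solidE (s b : 'M[R]_3) : b \in unitmx ->
  constitutive_equation spherical_solid s b <-> s = (\tr (invmx b))%:M.
Proof.
move=> bu; have b0 : \det b != 0 by rewrite -unitfE -unitmxE.
have I5E : 2^-1 * (\tr b ^+ 2 - \tr (b *m b)) = \det b * \tr (invmx b).
  by rewrite -tr_adj33 mulKf// /invmx bu linearZ/= mulrA divff// mul1r.
rewrite /constitutive_equation /spherical_solid !big_ord_recl big_ord0 /=.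
rewrite !scale0r !addr0 /invariants !mxE !inordK//= I5E mulN1r scaleNr.
rewrite -!scalerA -scalerN -scalerDr scalemx1.
split=> [/eqP|->].
  by rewrite scaler_eq0 (negPf b0) /= addrC subr_eq0 => /eqP.
by rewrite addNr scaler0.
Qed.

End Materials.

Theorem proposition3p3 (R : realType) (body : set 'rV[R]_3)
    (phi psi : 'rV[R]_3 -> 'rV[R]_3) :
  deformation body phi psi ->
  universal (phi @` body) (left_cauchy_green phi psi) ->
  homogeneous body phi psi.
Proof.
move=> def univ; set C := phi @` body in univ *.
have Co : open C := image_open def.
pose u (A : 'I_3) x := psi x 0 A.
have su A : smooth_on C (u A) := inverse_smooth def A.
pose G := deformation_gradient psi.
pose c x := (G x)^T *m G x.
have cE a d : (fun x => c x a d) =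
    fun x => \sum_A partial a (u A) x * partial d (u A) x.
  by apply/funext => x; rewrite mxE; apply: eq_bigr => A _; rewrite !mxE.
have smc a d : smooth_on C (fun x => c x a d).
  rewrite cE; apply: smooth_on_sum => // A k.
  by apply: Ck_onM => //; apply: smooth_on_partial.
pose b := left_cauchy_green phi psi.
have bc x : C x -> b x *m c x = 1%:M by exact: left_cauchy_greenV.
(* A right inverse of a square matrix is its inverse, so [c] is the tensor [invmx b] of the
   constitutive equation. *)
have bV x : C x -> b x \in unitmx /\ invmx (b x) = c x.
  move=> Cx; have [bu _] := mulmx1_unit (bc x Cx); split => //.
  by rewrite -[LHS]mulmx1 -(bc x Cx) mulKmx.
have divc : equilibrated C c.
  apply: (universal_equilibrated Co inverse_strain_solid_smooth _ _ univ).
    by split => // x _; rewrite trmx_mul trmxK.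
  by move=> x s /bV[_ <-]; exact: inverse_strain_solidE.
have trcE : (fun x => \tr (c x)) =
    fun x => \sum_d \sum_A partial d (u A) x * partial d (u A) x.
  apply/funext => x; apply: eq_bigr => d _.
  exact: (congr1 (fun f => f x) (cE d d)).
have strc : equilibrated C (fun x => (\tr (c x))%:M).
  apply: (universal_equilibrated Co spherical_solid_smooth _ _ univ).
    split=> [a d|x _]; last exact: tr_scalar_mx.
    have -> : (fun x => ((\tr (c x))%:M : 'M[R]_3) a d) =
        fun x => \sum_e c x e e * (a == d)%:R.
      by apply/funext => x; rewrite mxE -mulr_suml mulr_natr.
    apply: smooth_on_sum => // e k; apply: Ck_onM => //; first exact: smc.
    exact: Ck_on_cst.
  by move=> x s /bV[bu <-]; exact: spherical_solidE.
have hess0 a d A x : C x -> partial a (partial d (u A)) x = 0.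
  apply: (hessian_eq0 Co su) => {a d A x} [x Cx|a x Cx|a x Cx].
  - exists (deformation_gradient phi (psi x)); exact: (inverse_gradient_imageM def Cx).
  - rewrite -[RHS](divc x Cx a); by apply: eq_bigr => d _; rewrite cE.
  (* Row [a] of [(tr c) I] has only its diagonal entry, so component [a] of the divergence is
     [partial a] of [tr c]. *)
  - rewrite -trcE -[RHS](strc x Cx a) /divergence (bigD1 a)//= big1 ?addr0.
      by congr partial; apply/funext => y; rewrite mxE eqxx.
    move=> d da; under eq_fun do rewrite mxE eq_sym (negPf da).
    exact: partial_cst.
have Gcst x y : C x -> C y -> G x = G y.
  move=> Cx Cy; apply/matrixP => A d; rewrite !mxE.
  apply: (zero_partial_cst Co (connected_image def) _ _ Cx Cy) => [z Cz|a z Cz].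
    exact: smooth_on_differentiable (smooth_on_partial d (su A)) Cz.
  exact: hess0.
(* The body may be empty; any constant, here 0, then serves. *)
have [[x0 Cx0]|noC] := pselect (exists x, C x); last first.
  by exists 0 => x Cx; case: noC; exists x.
exists (b x0) => x Cx; have [bu cE1] := bV x Cx; have [bu0 cE0] := bV x0 Cx0.
(* [b] is recovered as the inverse of [c], which is constant because [G] is. *)
by rewrite -[LHS]invmxK -[RHS]invmxK -/(b x) cE1 cE0 /c (Gcst x x0).
Qed.
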